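(* Let $m\geq 2$, let $1\leq n_1\leq\cdots\leq n_m$ be integers, and let $\Gamma=K_{n_1,\ldots,n_m}$ be the complete multipartite graph with parts of sizes $n_1,\ldots,n_m$. Write $|\Gamma|=n_1+\cdots+n_m$ for the number of vertices. Then \[\max\left\{\frac{3}{2}|\Gamma|-n_m-1,\ |\Gamma|+\frac{m}{2}-2\right\}\leq\mathrm{pmd}(\Gamma)\leq2|\Gamma|-n_{m-1}-n_m-1.\]
   Context: A matching $M$ (a set of pairwise disjoint edges) of a graph $\Gamma=(V,E)$ is positive if there is $w\colon V\to\mathbb{R}$ with $w(u)+w(v)>0$ for every $uv\in M$ and $w(u)+w(v)<0$ for every $uv\in E\setminus M$. A positive matching decomposition (pmd) of $\Gamma$ is a partition $E=E_1\cup\cdots\cup E_p$ into pairwise disjoint subsets such that $E_i$ is a positive matching of $(V,E\setminus\bigcup_{j<i}E_j)$ for $i=1,\ldots,p$. $\mathrm{pmd}(\Gamma)$ denotes the smallest $p$ for which $\Gamma$ has a pmd with $p$ parts. *)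

(* Defs.v *)
From HB Require Import structures.
From mathcomp Require Import all_boot all_order all_algebra.
From mathcomp Require Import boolp reals.

Set Implicit Arguments.
Unset Strict Implicit.
Unset Printing Implicit Defensive.

Import Order.TTheory GRing.Theory Num.Theory.

Record sgraph := SGraph {
  vertex :> finType;
  edges : {set {set vertex}};
  edges_card2 : {in edges, forall e : {set vertex}, #|e| = 2}
}.

Lemma del_edges_card2 (G : sgraph) (F : {set {set G}}) :
  {in edges G :\: F, forall e : {set G}, #|e| = 2}.
Proof. by move=> e /setDP[/edges_card2]. Qed.

Definition del_edges (G : sgraph) (F : {set {set G}}) : sgraph :=
  SGraph (@del_edges_card2 G F).

Definition matching (G : sgraph) (M : {set {set G}}) : bool :=
  (M \subset edges G) && trivIset M.

Definition positive_matching (R : realType) (G : sgraph) (M : {set {set G}}) :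
    Prop :=
  matching M /\
  exists w : G -> R,
    (forall u v : G, [set u; v] \in M -> 0 < w u + w v)%R /\
    (forall u v : G, [set u; v] \in edges G :\: M -> w u + w v < 0)%R.

(* Empty parts are allowed; they do not affect the minimal number of parts,
   since deleting them from a decomposition leaves a shorter one. *)
Definition is_pmd (R : realType) (G : sgraph) (p : nat)
    (E : 'I_p -> {set {set G}}) : Prop :=
  [/\ \bigcup_(i < p) E i = edges G,
      forall i j : 'I_p, i != j -> [disjoint E i & E j] &
      forall i : 'I_p,
        positive_matching R
          (G := del_edges (\bigcup_(j < p | j < i) E j)) (E i)].

Definition has_pmd (R : realType) (G : sgraph) (p : nat) : Prop :=
  exists E : 'I_p -> {set {set G}}, is_pmd R E.

Lemma has_pmd_edges (R : realType) (G : sgraph) : has_pmd R G #|edges G|.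
Proof.
exists (fun i => [set enum_val i]); split.
- apply/setP => e; apply/bigcupP/idP => [[i _ /set1P->]|eG].
    exact: enum_valP.
  by exists (enum_rank_in eG e); rewrite // enum_rankK_in ?set11.
- move=> i j ij; rewrite disjoints1 inE; apply: contraNneq ij.
  by move/enum_val_inj->.
move=> i; split.
  rewrite /matching sub1set; apply/andP; split.
    rewrite inE enum_valP andbT; apply/bigcupP => -[j ji /set1P].
    by move/enum_val_inj => ij; rewrite ij ltnn in ji.
  by apply/trivIsetP => A B /set1P-> /set1P->; rewrite eqxx.
set e := enum_val i.
exists (fun v => if v \in e then 1%R else (- 2)%R); split => u v.
  move/set1P => uv.
  have -> : u \in e by rewrite -uv !inE eqxx.
  have -> : v \in e by rewrite -uv !inE eqxx orbT.
  by rewrite addr_gt0.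
rewrite !inE => /and3P[uve _ uvG].
have h3 : (1 - 2 < 0 :> R)%R by rewrite subr_lt0 ltr1n.
have h4 : (- 2 - 2 < 0 :> R)%R by rewrite -opprD oppr_lt0 addr_gt0.
case: ifP => ue; case: ifP => ve //; last by rewrite addrC.
case/eqP: uve; apply/eqP.
rewrite eqEcard (edges_card2 uvG) (edges_card2 (enum_valP i)) leqnn andbT.
by apply/subsetP => x; rewrite !inE => /orP[] /eqP->.
Qed.

Lemma ex_pmd (R : realType) (G : sgraph) : exists p, `[< has_pmd R G p >].
Proof. by exists #|edges G|; apply/asboolP/has_pmd_edges. Qed.

Definition pmd (R : realType) (G : sgraph) : nat := ex_minn (ex_pmd R G).

Lemma pmdP (R : realType) (G : sgraph) :
  has_pmd R G (pmd R G) /\ (forall p, has_pmd R G p -> pmd R G <= p).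
Proof.
rewrite /pmd; case: ex_minnP => p /asboolP hp minp; split=> // q hq.
by apply: minp; apply/asboolP.
Qed.

(* The vertex [Tagged _ k], with tag i, is the k-th vertex of the i-th part. *)
Definition multipartite_vertex (m : nat) (n : m.-tuple nat) : finType :=
  {i : 'I_m & 'I_(tnth n i)}.

Definition multipartite_edges (m : nat) (n : m.-tuple nat) :
    {set {set multipartite_vertex n}} :=
  [set e : {set multipartite_vertex n} |
    [exists u, exists v, (tag u != tag v) && (e == [set u; v])]].

Lemma multipartite_edges_card2 (m : nat) (n : m.-tuple nat) :
  {in multipartite_edges n, forall e : {set multipartite_vertex n}, #|e| = 2}.
Proof.
move=> e; rewrite inE => /existsP[u /existsP[v /andP[uv /eqP->]]].
by rewrite cards2; have -> : u != v by apply: contraNneq uv => ->.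
Qed.

Definition complete_multipartite (m : nat) (n : m.-tuple nat) : sgraph :=
  SGraph (@multipartite_edges_card2 m n).

Lemma card_complete_multipartite (m : nat) (n : m.-tuple nat) :
  #|complete_multipartite n| = \sum_(i < m) tnth n i.
Proof.
by rewrite card_tagged sumnE big_map big_enum /=; under eq_bigr do rewrite card_ord.
Qed.

(* Main.v *)
Require Import Defs.
From mathcomp Require Import all_boot all_order all_algebra.
From mathcomp Require Import boolp reals.
From mathcomp Require Import zify lra.

(** Lower bounds.  Let [p] stages decompose the graph, and say that a stage
    touches the ends of its edges.  Two facts are combined.

    - Every stage touches at most two vertices not touched before
      ([card_new]).  So the first [k] stages avoid some vertex as long as
      [2 k < N], and avoid some whole part as long as [2 k < m].
    - A complete bipartite piece between [A] and [B] meets at least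
      [#|A| + #|B| - 1] stages ([card_stages_between]), because its first stage
      is a single edge and deleting an end of that edge loses the stage.

    If the first [k] stages avoid [A], all stages of the piece come later, so
    [k + #|A| + #|B| - 1 <= p] ([untouched_bound]).  With [A] one vertex, [B]
    its neighbours and [k] about [N / 2], this is the bound [3/2 N - n_m - 1];
    with [A] a whole part, [B] its complement and [k] about [m / 2], it is the
    bound [N + m/2 - 2].

    Upper bound.  For any injective labelling of the vertices by integers, the
    classes of edges with equal label sum form a decomposition
    ([has_pmd_labelling]).  Labelling one of the two largest parts first and the
    other one last gives the smallest range of sums. *)

Set Implicit Arguments.
Unset Strict Implicit.
Unset Printing Implicit Defensive.

Import Order.TTheory GRing.Theory Num.Theory.

Local Open Scope ring_scope.

(** * Stages of a positive matching decomposition *)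

Section Decomposition.

Variables (R : realType) (G : sgraph) (p : nat) (E : 'I_p -> {set {set G}}).
Hypothesis pmdE : is_pmd R E.

Lemma pmd_cover (e : {set G}) : e \in edges G -> exists i, e \in E i.
Proof. by case: pmdE => <- _ _ /bigcupP[i _ ei]; exists i. Qed.

Lemma pmd_sub (e : {set G}) i : e \in E i -> e \in edges G.
Proof. by case: pmdE => <- _ _ ei; apply/bigcupP; exists i. Qed.

Lemma pmd_inj (e : {set G}) i j : e \in E i -> e \in E j -> i = j.
Proof.
case: pmdE => _ disjE _ ei ej; apply/eqP; apply: contraT => /disjE.
by move=> /pred0P/(_ e); rewrite /= ei ej.
Qed.

Lemma pmd_neq (u v : G) i : [set u; v] \in E i -> u != v.
Proof. by move/pmd_sub/edges_card2; rewrite cards2; case: eqP. Qed.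

Lemma pmd_partner (u v v' : G) i :
  [set u; v] \in E i -> [set u; v'] \in E i -> v = v'.
Proof.
move=> uv uv'; case: pmdE => _ _ /(_ i)[/andP[_ /trivIsetP tr] _].
have [e|/(tr _ _ uv uv')] := eqVneq [set u; v] [set u; v'].
  have : v \in [set u; v'] by rewrite -e !inE eqxx orbT.
  by rewrite !inE eq_sym (negPf (pmd_neq uv)) => /eqP.
by move=> /pred0P/(_ u); rewrite /= !inE eqxx.
Qed.

Lemma pmd_weight (i : 'I_p) : exists w : G -> R,
  (forall u v, [set u; v] \in E i -> 0 < w u + w v) /\
  (forall u v (j : 'I_p), [set u; v] \in E j -> (i < j)%N -> w u + w v < 0).
Proof.
case: (pmdE) => _ _ /(_ i)[_ [w [wpos wneg]]]; exists w; split=> // u v j uvj ij.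
apply: wneg; rewrite !inE (pmd_sub uvj) andbT; apply/andP; split.
  by apply/negP => /(pmd_inj uvj) ji; rewrite ji ltnn in ij.
by apply/bigcupP => -[l li /(pmd_inj uvj) jl]; rewrite jl in ij; lia.
Qed.

(** * Complete bipartite pieces *)

Definition stages_between (A B : {set G}) : {set 'I_p} :=
  [set i | [exists a in A, exists b in B, [set a; b] \in E i]].

Lemma stages_betweenP (A B : {set G}) i :
  reflect (exists a b, [/\ a \in A, b \in B & [set a; b] \in E i])
          (i \in stages_between A B).
Proof.
rewrite inE; apply: (iffP exists_inP) => [[a aA /exists_inP[b bB abi]]|].
  by exists a, b.
by move=> [a [b [aA bB abi]]]; exists a => //; apply/exists_inP; exists b.
Qed.

Lemma stages_betweenC (A B : {set G}) : stages_between A B = stages_between B A.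
Proof.
apply/setP => i; apply/stages_betweenP/stages_betweenP;
  by move=> [a [b [aA bB abi]]]; exists b, a; rewrite setUC.
Qed.

(** In a complete bipartite piece the earliest stage consists of a single edge
    [a b]: a second edge [a' b'] of that stage would close an alternating
    4-cycle whose other two edges [a b'], [a' b] come later.  Deleting [a]
    therefore removes a whole stage from the piece. *)
Lemma first_stage_removal (A B : {set G}) a b i :
    {in A & B, forall x y, [set x; y] \in edges G} ->
    a \in A -> b \in B -> [set a; b] \in E i ->
    {in stages_between A B, forall j : 'I_p, (i <= j)%N} ->
  (#|stages_between (A :\ a) B| < #|stages_between A B|)%N.
Proof.
move=> AB aA bB abi imin; apply: proper_card; apply/properP; split.
  apply/subsetP => j /stages_betweenP[x [y [/setD1P[_ xA] yB xyj]]].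
  by apply/stages_betweenP; exists x, y.
exists i; first by apply/stages_betweenP; exists a, b.
apply/stages_betweenP => -[x [y [/setD1P[xa xA] yB xyi]]].
have yb : y != b.
  apply: contraNneq xa => yb; move: xyi abi; rewrite yb.
  by rewrite setUC [[set a; b]]setUC => h1 h2; rewrite (pmd_partner h1 h2).
have [w [wpos wneg]] := pmd_weight i.
have [j ayj] := pmd_cover (AB _ _ aA yB).
have [l xbl] := pmd_cover (AB _ _ xA bB).
have ij : (i < j)%N.
  rewrite ltn_neqAle imin ?andbT; last by apply/stages_betweenP; exists a, y.
  apply: contraNneq yb => /val_inj ij; rewrite -ij in ayj.
  by rewrite (pmd_partner ayj abi).
have il : (i < l)%N.
  rewrite ltn_neqAle imin ?andbT; last by apply/stages_betweenP; exists x, b.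
  apply: contraNneq yb => /val_inj il; rewrite -il in xbl.
  by rewrite (pmd_partner xyi xbl).
have := wpos _ _ abi; have := wpos _ _ xyi.
have := wneg _ _ _ ayj ij; have := wneg _ _ _ xbl il; lra.
Qed.

(** Induction on the size of the piece by [first_stage_removal]: each of the
    [#|A| + #|B| - 2] deletions that reduce it to one edge loses a stage. *)
Lemma card_stages_between (A B : {set G}) :
    A != set0 -> B != set0 ->
    {in A & B, forall x y, [set x; y] \in edges G} ->
  (#|A| + #|B| <= #|stages_between A B|.+1)%N.
Proof.
have [n] := ubnP (#|A| + #|B|)%N; elim: n A B => // n IH A B ltn A0 B0 AB.
have [[a aA] [b bB]] := (set0Pn _ A0, set0Pn _ B0).
have [i0 abi0] := pmd_cover (AB _ _ aA bB).
have i0S : i0 \in stages_between A B by apply/stages_betweenP; exists a, b.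
case: (arg_minnP (fun i : 'I_p => val i) i0S) => i iS imin.
case/stages_betweenP: (iS) => {aA bB abi0}a [{}b [aA bB abi]].
have cA := cardsD1 a A; have cB := cardsD1 b B; rewrite aA in cA; rewrite bB in cB.
have [Aa0|Aa0] := eqVneq (A :\ a) set0; last first.
  have := first_stage_removal AB aA bB abi imin.
  have : {in A :\ a & B, forall x y, [set x; y] \in edges G}.
    by move=> x y /setD1P[_]; apply: AB.
  move/(IH _ _ _ Aa0 B0); lia.
(* [A] is the single vertex [a], so a vertex of [B] is deleted instead. *)
have [Bb0|Bb0] := eqVneq (B :\ b) set0.
  rewrite Aa0 cards0 in cA; rewrite Bb0 cards0 in cB.
  have : (0 < #|stages_between A B|)%N by apply/card_gt0P; exists i.
  lia.
have BA : {in B & A, forall x y, [set x; y] \in edges G}.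
  by move=> x y xB yA; rewrite setUC AB.
rewrite stages_betweenC in imin *; rewrite setUC in abi.
have := first_stage_removal BA bB aA abi imin.
have : {in B :\ b & A, forall x y, [set x; y] \in edges G}.
  by move=> x y /setD1P[_]; apply: BA.
move/(IH _ _ _ Bb0 A0); lia.
Qed.

(** * Vertices touched by the first stages *)

Definition touched (k : nat) : {set G} :=
  [set v | [exists i : 'I_p, (i < k)%N && [exists u, [set v; u] \in E i]]].

Lemma touchedP k v :
  reflect (exists (i : 'I_p) u, (i < k)%N /\ [set v; u] \in E i)
          (v \in touched k).
Proof.
rewrite inE; apply: (iffP existsP).
  by move=> [i /andP[ik /existsP[u vui]]]; exists i, u.
by move=> [i [u [ik vui]]]; exists i; rewrite ik; apply/existsP; exists u.
Qed.

(** All stages of the piece between [A] and [B] touch [A], so they lie among the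
    last [p - k], and [card_stages_between] says how many there are. *)
Lemma untouched_bound k (A B : {set G}) :
    A != set0 -> B != set0 ->
    {in A & B, forall x y, [set x; y] \in edges G} ->
    [disjoint A & touched k] ->
  (k + (#|A| + #|B|) <= p.+1)%N.
Proof.
move=> A0 B0 AB Ak; have leAB := card_stages_between A0 B0 AB.
have Sk : stages_between A B \subset [set i : 'I_p | (k <= i)%N].
  apply/subsetP => i /stages_betweenP[a [b [aA bB abi]]].
  rewrite inE leqNgt; apply/negP => ik.
  move/pred0P/(_ a): Ak; rewrite /= aA /= => /negP[].
  by apply/touchedP; exists i, b.
have leS : (#|stages_between A B| <= p - k)%N.
  apply: leq_trans (subset_leq_card Sk) _.
  rewrite cardsE cardE -(size_map val) -(size_iota k (p - k)).
  apply: uniq_leq_size; first by rewrite map_inj_uniq ?enum_uniq //; apply: val_inj.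
  move=> x /mapP[i]; rewrite mem_enum => ki ->.
  have := ltn_ord i; rewrite mem_iota /=; move: (ki : (k <= i)%N); lia.
rewrite -!card_gt0 in A0 B0; lia.
Qed.

Variables (I : finType) (part : G -> I).
Hypothesis partE : forall u v, ([set u; v] \in edges G) = (part u != part v).

(** Let [x1], [x2], [x3] be first touched at the same stage, by edges [xi yi],
    numbered by increasing weight of the [yi].  If [xi] and [yj] are adjacent,
    their edge comes after the stage, because [xi] is new and [yj] is already
    matched to [xj]; so
    [w xi + w yj < 0 < w xi + w yi] and [w yj < w yi].  Hence [x1] lies in the
    part of [y2], and both [x1] and [x2] lie in the part of [y3]; this puts
    [x2] in the part of its neighbour [y2]. *)
Lemma card_new k : (#|touched k.+1 :\: touched k| <= 2)%N.
Proof.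
rewrite leqNgt; apply/negP => /card_gt2P[x1 [x2 [x3 [[x1P x2P x3P]]]]].
move=> [x12 x23 x31].
have stage_new x : x \in touched k.+1 :\: touched k ->
    exists (i : 'I_p) y, i = k :> nat /\ [set x; y] \in E i.
  move=> /setDP[/touchedP[i [y [ik xyi]]] xk]; exists i, y; split=> //.
  apply/eqP; rewrite eqn_leq -ltnS ik leqNgt; apply: contra xk => ik'.
  by apply/touchedP; exists i, y.
have [i [y1 [ik xy1]]] := stage_new _ x1P.
have [i2 [y2 [ik2 xy2]]] := stage_new _ x2P.
have [i3 [y3 [ik3 xy3]]] := stage_new _ x3P.
have {ik2} ? : i2 = i by apply: val_inj; rewrite /= ik2 ik.
have {ik3} ? : i3 = i by apply: val_inj; rewrite /= ik3 ik.
subst i2 i3; have [w [wpos wneg]] := pmd_weight i.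
pose new x y := x \notin touched k /\ [set x; y] \in E i.
have same_part x y x' y' : new x y -> new x' y' -> x != x' ->
    w y <= w y' -> part x = part y'.
  move=> [xk xyi] [_ xyi'] xx' wyy'; apply/eqP; apply: contraT => adj.
  rewrite -partE in adj; have [j xyj] := pmd_cover adj.
  have ij : (i < j)%N.
    rewrite ltn_neqAle; apply/andP; split.
      apply: contraNneq xx' => /val_inj ij; rewrite -ij setUC in xyj.
      by rewrite setUC in xyi'; rewrite (pmd_partner xyj xyi').
    rewrite leqNgt; apply: contra xk => ji.
    by apply/touchedP; exists j, y'; rewrite -ik.
  have := wpos _ _ xyi; have := wneg _ _ _ xyj ij; lra.
have sorted_absurd u1 v1 u2 v2 u3 v3 : new u1 v1 -> new u2 v2 -> new u3 v3 ->
    u1 != u2 -> u2 != u3 -> u3 != u1 -> w v1 <= w v2 -> w v2 <= w v3 -> False.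
  move=> n1 n2 n3 u12 u23 u31 w12 w23; rewrite eq_sym in u31.
  have p2 : part u2 != part v2 by rewrite -partE; case: n2 => _ /pmd_sub.
  move: p2; rewrite -(same_part _ _ _ _ n1 n2 u12 w12).
  rewrite (same_part _ _ _ _ n1 n3 u31 (le_trans w12 w23)).
  by rewrite (same_part _ _ _ _ n2 n3 u23 w23) eqxx.
have n1 : new x1 y1 by split=> //; case/setDP: x1P.
have n2 : new x2 y2 by split=> //; case/setDP: x2P.
have n3 : new x3 y3 by split=> //; case/setDP: x3P.
have [[x21 x32] x13] : (x2 != x1 /\ x3 != x2) /\ x1 != x3.
  by rewrite ![_ == x1]eq_sym [x3 == x2]eq_sym [x1 == x3]eq_sym.
case: (leP (w y1) (w y2)) => w12; case: (leP (w y2) (w y3)) => w23;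
  case: (leP (w y1) (w y3)) => w13.
- exact: (sorted_absurd _ _ _ _ _ _ n1 n2 n3).
- by have := le_lt_trans (le_trans w12 w23) w13; rewrite ltxx.
- exact: (sorted_absurd _ _ _ _ _ _ n1 n3 n2 _ _ _ w13 (ltW w23)).
- exact: (sorted_absurd _ _ _ _ _ _ n3 n1 n2 _ _ _ (ltW w13) w12).
- exact: (sorted_absurd _ _ _ _ _ _ n2 n1 n3 _ _ _ (ltW w12) w13).
- exact: (sorted_absurd _ _ _ _ _ _ n2 n3 n1 _ _ _ w23 (ltW w13)).
- by have := lt_trans w23 w12; rewrite ltNge w13.
- exact: (sorted_absurd _ _ _ _ _ _ n3 n2 n1 _ _ _ (ltW w23) (ltW w12)).
Qed.

Lemma card_touched k : (#|touched k| <= 2 * k)%N.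
Proof.
elim: k => [|k IH].
  rewrite muln0 leqn0 cards_eq0; apply/eqP/setP => v; rewrite in_set0.
  by apply/touchedP => -[i [u []]].
have := card_new k; rewrite cardsD.
have := subset_leq_card (subsetIr (touched k.+1) (touched k)).
lia.
Qed.

(** * Lower bounds for complete multipartite graphs *)

Definition class (c : I) : {set G} := [set v | part v == c].

(** Two new vertices per stage leave some vertex [v] untouched by the first
    [(#|G| - 1) / 2] stages, and the star of [v] takes one later stage per
    neighbour. *)
Lemma vertex_bound n :
    (0 < #|G|)%N -> (forall v, (#|class (part v)| <= n)%N) -> (n < #|G|)%N ->
  (3 * #|G| <= 2 * p + 2 * n + 2)%N.
Proof.
move=> G0 cn nG; set k := (#|G|.-1)./2.
have [v vk] : exists v, v \notin touched k.
  apply/existsP; rewrite -negb_forall; apply/negP => /forallP all_touched.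
  have : (#|G| <= 2 * k)%N.
    apply: leq_trans (card_touched k).
    by apply/subset_leq_card/subsetP => x _; apply: all_touched.
  by rewrite /k; lia.
have := cardsC (class (part v)); have := cn v => cv cC.
have : (k + (#|[set v]| + #|~: class (part v)|) <= p.+1)%N.
  apply: untouched_bound.
  - by rewrite -card_gt0 cards1.
  - rewrite -card_gt0; lia.
  - by move=> x y /set1P-> ; rewrite !inE partE eq_sym.
  - by rewrite disjoints1.
by rewrite cards1 /k; lia.
Qed.

(** Since every stage touches at most two new vertices, it touches at most two
    new parts; so some part [A] is avoided by the first [(#|I| - 1) / 2]
    stages, and the complete bipartite graph between [A] and its complement
    takes [#|G| - 1] further stages. *)
Lemma class_bound :
    (1 < #|I|)%N -> (forall c, class c != set0) ->
  (2 * #|G| + #|I| <= 2 * p + 4)%N.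
Proof.
move=> I1 class0; set k := (#|I|.-1)./2.
have [c ck] : exists c, c \notin part @: touched k.
  apply/existsP; rewrite -negb_forall; apply/negP => /forallP all_touched.
  have : (#|I| <= 2 * k)%N.
    apply: leq_trans (leq_trans (leq_imset_card part _) (card_touched k)).
    by apply/subset_leq_card/subsetP => x _; apply: all_touched.
  by rewrite /k; lia.
have [d dc] : exists d, d != c.
  have /card_gt1P[x [y [_ _ xy]]] := I1.
  by have [xc|xc] := eqVneq x c; [exists y; rewrite -xc eq_sym | exists x].
have : (k + (#|class c| + #|~: class c|) <= p.+1)%N.
  apply: untouched_bound => //.
  - have /set0Pn[v] := class0 d; rewrite inE => /eqP vd.
    by apply/set0Pn; exists v; rewrite !inE vd.
  - by move=> x y; rewrite !inE partE => /eqP->; rewrite eq_sym.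
  - rewrite -setI_eq0; apply/eqP/setP => v; rewrite !in_set0 in_setI.
    apply/negP => /andP[]; rewrite inE => /eqP vc vk.
    by move: ck; rewrite -vc imset_f.
by rewrite cardsC /k; lia.
Qed.

End Decomposition.

(** * Decompositions from labellings *)

(** Taking as stages the edges of constant label sum, in increasing order, works
    for any graph: at stage [s] the weight [2 s + 1 - 4 f v] gives an edge the
    total [4 (s - sum) + 2], which is positive on the stage itself and negative
    on the edges of larger sum. *)
Lemma has_pmd_labelling (R : realType) (G : sgraph) (f : G -> nat) (lo p : nat) :
    injective f ->
    (forall u v : G, [set u; v] \in edges G -> (lo <= f u + f v < lo + p)%N) ->
  has_pmd R G p.
Proof.
move=> injf range.
pose sum (e : {set G}) := (\sum_(v in e) f v)%N.
have sumE u v : u != v -> sum [set u; v] = (f u + f v)%N.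
  by move=> uv; rewrite /sum big_setU1 ?inE //= big_set1.
have edge_neq u v : [set u; v] \in edges G -> u != v.
  by move/edges_card2; rewrite cards2; case: eqP.
have edge_ends (e : {set G}) x : e \in edges G -> x \in e ->
    exists2 y, e = [set x; y] & x != y.
  move=> eG; have /cards2P[u [v [uv ->]]] : #|e| == 2%N by rewrite edges_card2.
  by rewrite !inE => /orP[]/eqP->; [exists v | exists u; rewrite 1?setUC // eq_sym].
pose E (i : 'I_p) := [set e in edges G | sum e == lo + i]%N.
exists E; split.
- apply/setP => e; apply/bigcupP/idP => [[i _]|eG]; first by rewrite inE => /andP[].
  have /cards2P[u [v [uv euv]]] : #|e| == 2%N by rewrite edges_card2.
  have := eG; rewrite {1}euv => /range /andP[lo_le lt_hi].
  have ip : (f u + f v - lo < p)%N by lia.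
  by exists (Ordinal ip) => //; rewrite inE eG euv sumE //=; apply/eqP; lia.
- move=> i j; apply: contraNT => /pred0Pn[e /=]; rewrite !inE.
  by move=> /andP[/andP[_ /eqP->]]; rewrite eqn_add2l => /andP[_] /eqP/val_inj->.
move=> i; split.
  apply/andP; split.
    apply/subsetP => e; rewrite !inE => /andP[eG /eqP si]; rewrite eG andbT.
    apply/bigcupP => -[j ji]; rewrite inE eG si eqn_add2l /= => /eqP ij.
    by rewrite ij ltnn in ji.
  apply/trivIsetP => A B; rewrite !inE => /andP[AG /eqP sA] /andP[BG /eqP sB].
  apply: contraNT => /pred0Pn[x /= /andP[xA xB]].
  have [a Aa xa] := edge_ends _ _ AG xA; have [b Bb xb] := edge_ends _ _ BG xB.
  move: sB; rewrite -sA Aa Bb !sumE // => /eqP; rewrite eqn_add2l => /eqP.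
  by move/injf->.
exists (fun v => (2 * (lo + i) + 1)%:R - (4 * f v)%:R); split => u v.
  rewrite inE => /andP[/edge_neq uv]; rewrite sumE // => /eqP s.
  have -> : (2 * (lo + i) + 1)%:R - (4 * f u)%:R +
      ((2 * (lo + i) + 1)%:R - (4 * f v)%:R) = 2%:R :> R.
    have /(congr1 (fun n => n%:R : R)) := s; rewrite !(natrD, natrM); lra.
  by rewrite ltr0n.
rewrite inE => /andP[uvi]; rewrite inE => /andP[uvj uvG].
have uv := edge_neq _ _ uvG; have /andP[lo_le lt_hi] := range _ _ uvG.
have : (lo + i + 1 <= f u + f v)%N.
  rewrite addn1 ltnNge; apply/negP => s_le.
  have jp : (f u + f v - lo < p)%N by lia.
  have uvE : [set u; v] \in E (Ordinal jp).
    by rewrite inE uvG sumE //=; apply/eqP; lia.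
  have [ji|ij] := ltnP (Ordinal jp) i.
    by case/negP: uvj; apply/bigcupP; exists (Ordinal jp).
  case/negP: uvi; suff -> : i = Ordinal jp by [].
  by apply: val_inj; move: ij => /=; lia.
by rewrite -(ler_nat R) !(natrD, natrM) /=; lra.
Qed.

(** * The complete multipartite graph *)

Section Multipartite.

Variables (m : nat) (n : m.-tuple nat).

Let G := complete_multipartite n.

Lemma multipartite_edgeE (u v : G) :
  ([set u; v] \in edges G) = (tag u != tag v).
Proof.
rewrite inE; apply/existsP/idP => [[a /existsP[b /andP[ab /eqP uvab]]]|uv].
  have uv : u != v.
    have : #|[set u; v]| = 2%N.
      by rewrite uvab cards2; have -> : a != b by apply: contraNneq ab => ->.
    by rewrite cards2; case: eqP.
  have : u \in [set a; b] by rewrite -uvab !inE eqxx.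
  have : v \in [set a; b] by rewrite -uvab !inE eqxx orbT.
  rewrite !inE => /orP[]/eqP hv /orP[]/eqP hu; move: uv ab; rewrite hu hv ?eqxx //.
  by rewrite eq_sym [tag a == _]eq_sym.
by exists u; apply/existsP; exists v; rewrite uv eqxx.
Qed.

Lemma card_multipartite_class (i : 'I_m) :
  #|class (G := G) (fun v => tag v) i| = tnth n i.
Proof.
rewrite -[RHS]card_ord -cardsT.
have inj : injective (fun k : 'I_(tnth n i) => Tagged (fun i => 'I_(tnth n i)) k : G).
  by move=> k l /eqP; rewrite eq_Tagged /= => /eqP.
rewrite -(card_imset _ inj); apply: eq_card => v; rewrite inE.
apply/eqP/imsetP => [vi|[k _ ->] //].
by case: v vi => j k /= ji; subst j; exists k.
Qed.

(** Number the vertices with part [a] first and part [b] last: an edge has an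
    end outside part [a] and an end outside part [b], so both extreme ranges
    of label sums are missing. *)
Lemma has_pmd_multipartite (R : realType) (a b : 'I_m) : a != b ->
  has_pmd R G (2 * #|G| - tnth n a - tnth n b - 1).
Proof.
move=> ab; pose part (i : 'I_m) := class (G := G) (fun v => tag v) i.
pose mid := ~: (part a :|: part b).
pose s := enum (part a) ++ enum mid ++ enum (part b).
pose f (v : G) := index v s.
have mems v : v \in s.
  by rewrite !mem_cat !mem_enum !inE; case: (tag v == a); case: (tag v == b).
have size_s : size s = #|G|.
  rewrite /s !size_cat -!cardE addnCA -(cardsC (part a :|: part b)) addnC.
  rewrite cardsU -/mid; suff -> : part a :&: part b = set0 by rewrite cards0 subn0.
  apply/setP => v; rewrite !inE; apply/negP => /andP[/eqP-> ].
  by rewrite (negPf ab).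
have lt_s v : (f v < #|G|)%N by rewrite -size_s index_mem.
have ca : size (enum (part a)) = tnth n a by rewrite -cardE card_multipartite_class.
have cb : size (enum (part b)) = tnth n b by rewrite -cardE card_multipartite_class.
have above_a v : tag v != a -> (tnth n a <= f v)%N.
  by move=> va; rewrite /f /s index_cat mem_enum inE (negPf va) ca leq_addr.
have below_b v : tag v != b -> (f v + tnth n b < #|G|)%N.
  move=> vb; rewrite -size_s /f /s catA size_cat cb ltn_add2r index_cat.
  suff vm : v \in enum (part a) ++ enum mid by rewrite vm index_mem.
  by have := mems v; rewrite /s catA mem_cat [v \in enum (part b)]mem_enum inE (negPf vb) orbF.
apply: (@has_pmd_labelling R G f (tnth n a)).
  by move=> u v uv; rewrite -(nth_index u (mems u)) -/(f u) uv nth_index.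
move=> u v; rewrite multipartite_edgeE => uv.
have lo_le : (tnth n a <= f u + f v)%N.
  have [ua|/above_a] := eqVneq (tag u) a; last lia.
  have /above_a : tag v != a by rewrite -ua eq_sym.
  lia.
have lt_hi : (f u + f v + tnth n b + 1 < 2 * #|G|)%N.
  have := lt_s u; have := lt_s v.
  have [ub|/below_b] := eqVneq (tag u) b; last lia.
  have /below_b : tag v != b by rewrite -ub eq_sym.
  lia.
lia.
Qed.

End Multipartite.

Theorem theorem3p5 (R : realType) (m : nat) (hm : (2 <= m)%N)
    (n : m.-tuple nat) (hn1 : forall i : 'I_m, (1 <= tnth n i)%N)
    (hn : forall i j : 'I_m, (i <= j)%N -> (tnth n i <= tnth n j)%N) :
  let G := complete_multipartite n in
  let N : R := (\sum_(i < m) tnth n i)%:R in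
  let nm : R := (nth 0%N n (m - 1))%:R in
  let nm1 : R := (nth 0%N n (m - 2))%:R in
  Num.max (3 / 2 * N - nm - 1) (N + m%:R / 2 - 2) <= (pmd R G)%:R :> R /\
  (pmd R G)%:R <= 2 * N - nm1 - nm - 1 :> R.
Proof.
move=> G N nm nm1.
have lt1 : (m - 1 < m)%N by lia.
have lt2 : (m - 2 < m)%N by lia.
pose b := Ordinal lt1; pose a := Ordinal lt2.
have ab : a != b by rewrite -val_eqE /=; lia.
have nmE : nm = (tnth n b)%:R by rewrite /nm (tnth_nth 0%N).
have nm1E : nm1 = (tnth n a)%:R by rewrite /nm1 (tnth_nth 0%N).
have NE : N = #|G|%:R by rewrite card_complete_multipartite.
have card_ab : (tnth n a + tnth n b <= #|G|)%N.
  rewrite card_complete_multipartite (bigD1 b) //= (bigD1 a) //=; lia.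
have na := hn1 a.
have [[E pmdE] pmd_min] := pmdP R G.
set p := pmd R G in E pmdE pmd_min *.
have edgeE := @multipartite_edgeE m n.
have vertex : (3 * #|G| <= 2 * p + 2 * tnth n b + 2)%N.
  apply: (vertex_bound pmdE edgeE); [lia | move=> v | lia].
  rewrite card_multipartite_class; apply: hn => /=.
  by case: (tag v) => i /= im; lia.
have parts : (2 * #|G| + #|'I_m| <= 2 * p + 4)%N.
  apply: (class_bound pmdE edgeE); first by rewrite card_ord.
  by move=> c; rewrite -card_gt0 card_multipartite_class; apply: hn1.
have upper : (p + tnth n a + tnth n b + 1 <= 2 * #|G|)%N.
  have : (p <= 2 * #|G| - tnth n a - tnth n b - 1)%N.
    exact: pmd_min (has_pmd_multipartite n R ab).
  lia.
rewrite card_ord in parts; rewrite NE nmE nm1E.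
move: vertex parts upper; rewrite -!(ler_nat R) !(natrD, natrM) => vertex parts upper.
split; last by lra.
by rewrite ge_max; apply/andP; split; lra.
Qed.
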